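(* For every two ultrafilters $\mathcal F,\mathcal G\in\beta N$ the following are equivalent: (i) $\mathcal F\,\widetilde{\mid}\,\mathcal G$; (ii) in every enlargement $V({}^*N)$ there are $x,y\in{}^*N$ with $v(x)=\mathcal F$, $v(y)=\mathcal G$ and $x\,{}^*\!\!\mid y$; (iii) in some enlargement $V({}^*N)$ there are $x,y\in{}^*N$ with $v(x)=\mathcal F$, $v(y)=\mathcal G$ and $x\,{}^*\!\!\mid y$.
   Context: $N=\{0,1,2,\dots\}$; $\beta N$ is the set of ultrafilters on $N$. $V(N)$ is the superstructure over $N$; a nonstandard extension is a rank-preserving map ${}^*:V(N)\to V({}^*N)$ with ${}^*n=n$ for $n\in N$ satisfying the transfer principle for bounded formulas. A binary relation $\rho\in V(N)$ is concurrent if for any finitely many $a_1,\dots,a_k$ in its domain there is $b$ with $a_i\rho b$ for all $i$; the extension is an enlargement if for every concurrent $\rho$ there is $x$ with ${}^*a\,{}^*\rho\, x$ for all $a$ in the domain of $\rho$. For $x\in{}^*N$, $v(x)=\{S\subseteq N:x\in{}^*S\}$. ${}^*\!\!\mid$ is the extension of divisibility to ${}^*N$. For $A\subseteq N$, $A{\uparrow}=\{n\in N:\exists a\in A\ a\mid n\}$, and $\mathcal U=\{A\subseteq N:A{\uparrow}=A\}$. For $\mathcal F,\mathcal G\in\beta N$, $\mathcal F\,\widetilde{\mid}\,\mathcal G$ iff $\mathcal F\cap\mathcal U\subseteq\mathcal G$. *)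

(* Defs.v *)
From mathcomp Require Import all_boot.
From mathcomp Require Import all_classical.

Set Implicit Arguments.
Unset Strict Implicit.
Unset Printing Implicit Defensive.

Local Open Scope classical_set_scope.

(** * Superstructures *)

(** [stage X n] is V_n(X), where V_0(X) = X and
    V_{n+1}(X) = V_n(X) `|` P(V_n(X)) = X `|` P(V_n(X)); the elements of [X] are
    atoms.  The inclusion of V_n(X) in V_{n+1}(X) is the injection [raise]. *)
Fixpoint stage (X : Type) (n : nat) : Type :=
  if n is n'.+1 then (X + set (stage X n'))%type else X.

Fixpoint raise (X : Type) (n : nat) : stage X n -> stage X n.+1 :=
  match n return stage X n -> stage X n.+1 with
  | 0 => fun x => inl x
  | n'.+1 => fun x =>
      match x with
      | inl a => inl a
      | inr A => inr ((@raise X n') @` A)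
      end
  end.

(** [raises_to x y]: [x] in V_n(X) and [y] in V_m(X) denote the same object, and
    n <= m. *)
Inductive raises_to (X : Type) (n : nat) (x : stage X n) :
    forall m : nat, stage X m -> Prop :=
| raises_to_refl : raises_to x x
| raises_to_step m (y : stage X m) : raises_to x y -> raises_to x (raise y).

Definition minimal (X : Type) (n : nat) : stage X n -> Prop :=
  match n return stage X n -> Prop with
  | 0 => fun=> True
  | n'.+1 => fun x => ~ exists y : stage X n', x = raise y
  end.

(** An object of V(X) is given by its representative in the first stage V_n(X)
    in which it occurs, so that equality in V(X) is Leibniz equality and n is the
    rank of the object. *)
Record superstr (X : Type) : Type := Superstr {
  rank : nat;
  rep : stage X rank;
  rep_minimal : minimal rep }.

Definition stage_mem (X : Type) (m : nat) (a : stage X m) (n : nat) :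
    stage X n -> Prop :=
  match n return stage X n -> Prop with
  | 0 => fun=> False
  | n'.+1 => fun b =>
      match b with
      | inl _ => False
      | inr B => exists2 c : stage X n', B c & raises_to a c
      end
  end.

Definition smem (X : Type) (a b : superstr X) : Prop :=
  stage_mem (rep a) (rep b).

Definition atom (X : Type) (x : X) : superstr X := @Superstr X 0 x I.

Lemma atoms_minimal (X : Type) (A : set X) : @minimal X 1 (inr A).
Proof. by case=> y. Qed.

(** A set of atoms, as an object of rank 1. *)
Definition atoms (X : Type) (A : set X) : superstr X :=
  @Superstr X 1 (inr A) (@atoms_minimal X A).

Lemma ex_rep (X : Type) (n : nat) (x : stage X n) :
  exists a : superstr X, raises_to (rep a) x.
Proof.
elim: n x => [|n IH] x; first by exists (atom x); exact: raises_to_refl.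
have [[y ->]|nr] := pselect (exists y : stage X n, x = raise y).
  by have [a ay] := IH y; exists a; exact: raises_to_step.
by exists (@Superstr X n.+1 x nr); exact: raises_to_refl.
Qed.

(** The object denoted by an element of V_n(X). *)
Definition denote (X : Type) (n : nat) (x : stage X n) : superstr X :=
  sval (cid (ex_rep x)).

(** The set of all objects of rank at most [n] satisfying [P] (see [mem_setof]). *)
Definition setof (X : Type) (n : nat) (P : set (superstr X)) : superstr X :=
  @denote X n.+1 (inr [set c | exists2 a, P a & raises_to (rep a) c]).

Definition upair (X : Type) (a b : superstr X) : superstr X :=
  setof (maxn (rank a) (rank b)) [set c | c = a \/ c = b].

(** Kuratowski pairs. *)
Definition opair (X : Type) (a b : superstr X) : superstr X :=
  upair (upair a a) (upair a b).

Section Adequacy.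
Variable X : Type.

Lemma raise_inj n : injective (@raise X n).
Proof.
elim: n => [|n IH] /= x y; first by case.
case: x y => [a|A] [b|B] //= [] e; first by rewrite e.
congr inr.
by apply/seteqP; split=> c Ac;
  [have : (@raise X n @` B) (raise c) by rewrite -e; exists c
  |have : (@raise X n @` A) (raise c) by rewrite e; exists c];
  case=> d dB /IH <-.
Qed.

Lemma raises_to_leq m (x : stage X m) n (y : stage X n) :
  raises_to x y -> m <= n.
Proof. by elim=> // k z _; exact: leqW. Qed.

Lemma raises_toE m (x : stage X m) n (y : stage X n) : raises_to x y ->
  Tagged (stage X) y = Tagged (stage X) x \/
  exists k (z : stage X k),
    Tagged (stage X) y = Tagged (stage X) (raise z) /\ raises_to x z.
Proof. by case=> [|k z xz]; [left|right; exists k, z]. Qed.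

Lemma raises_toS m (x : stage X m) n (y : stage X n) :
  raises_to x (raise y) ->
  Tagged (stage X) (raise y) = Tagged (stage X) x \/ raises_to x y.
Proof.
move=> /raises_toE[|[k [z [e xz]]]]; [by left|right].
have ek : n = k by have := congr1 tag e => -[].
subst k.
by have /raise_inj -> := eq_from_Tagged e.
Qed.

Lemma raises_to_linear m (x : stage X m) n (y : stage X n) k (z : stage X k) :
  raises_to x z -> raises_to y z -> raises_to x y \/ raises_to y x.
Proof.
elim=> [|l w xw IH]; first by right.
move=> /raises_toS[e|/IH//]; left.
have el : l.+1 = n by have := congr1 tag e.
subst n.
by have <- := eq_from_Tagged e; exact: raises_to_step.
Qed.

Lemma raises_to_fun m (x : stage X m) n (y z : stage X n) :
  raises_to x y -> raises_to x z -> y = z.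
Proof.
move=> xy; elim: xy z => [|k w xw IH] z /raises_toE.
  move=> [e|[l [t [e xt]]]]; first by rewrite (eq_from_Tagged e).
  by have h := raises_to_leq xt; have em := congr1 tag e;
    rewrite /= in em; rewrite em ltnn in h.
move=> [e|[l [t [e xt]]]].
  by have h := raises_to_leq xw; have em := congr1 tag e;
    rewrite /= in em; rewrite -em ltnn in h.
have ek : k = l by have := congr1 tag e => -[].
by subst l; rewrite (eq_from_Tagged e) (IH t).
Qed.

Lemma superstr_eq (a b : superstr X) :
  Tagged (stage X) (rep a) = Tagged (stage X) (rep b) -> a = b.
Proof.
case: a b => [m x mx] [n y my] /= e.
have emn : m = n by have := congr1 tag e.
subst n; have exy := eq_from_Tagged e; subst y.
by congr Superstr; exact: Prop_irrelevance.
Qed.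

Lemma raises_to_rep (a b : superstr X) : raises_to (rep a) (rep b) -> a = b.
Proof.
move=> /raises_toE[/esym/superstr_eq//|[k [z [e _]]]].
case: b e => [n y my] /= e; have en : n = k.+1 by have := congr1 tag e.
by subst n; case: my; exists z; exact: (eq_from_Tagged e).
Qed.

Lemma raises_to_uniq (a b : superstr X) n (c : stage X n) :
  raises_to (rep a) c -> raises_to (rep b) c -> a = b.
Proof.
by move=> ac bc; have [/raises_to_rep|/raises_to_rep] :=
  raises_to_linear ac bc.
Qed.

Lemma denoteP n (x : stage X n) : raises_to (rep (denote x)) x.
Proof. by rewrite /denote; case: cid. Qed.

Lemma raises_to_ex m (x : stage X m) n : m <= n ->
  exists y : stage X n, raises_to x y.
Proof.
elim: n => [|n IH].
  by rewrite leqn0 => /eqP e; subst m; exists x; exact: raises_to_refl.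
rewrite leq_eqVlt => /orP[/eqP e|/IH[y xy]].
  by subst m; exists x; exact: raises_to_refl.
by exists (raise y); exact: raises_to_step.
Qed.

Lemma raises_to_trans m (x : stage X m) n (y : stage X n) k (z : stage X k) :
  raises_to x y -> raises_to y z -> raises_to x z.
Proof. by move=> xy; elim=> // l w _; exact: raises_to_step. Qed.

Lemma stage_mem_raise m (a : stage X m) n (b : stage X n) :
  minimal a -> stage_mem a (raise b) <-> stage_mem a b.
Proof.
case: n b => [|n] //= [//|B] ma; split=> [[_ [d Bd <-]]|[c Bc ac]].
  move=> /raises_toS[e|]; last by exists d.
  have em : n.+1 = m by have := congr1 tag e.
  by subst m; case: ma; exists d; rewrite (eq_from_Tagged e).
by exists (raise c); [exists c|exact: raises_to_step].
Qed.

Lemma stage_mem_raises_to m (a : stage X m) n (b : stage X n) k (c : stage X k) :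
  minimal a -> raises_to b c -> stage_mem a c <-> stage_mem a b.
Proof.
by move=> ma; elim=> // l y _ IH; split=> [/(stage_mem_raise _ ma)/IH|/IH h] //;
  exact/stage_mem_raise.
Qed.

Lemma mem_setof n (P : set (superstr X)) (a : superstr X) :
  smem a (setof n P) <-> P a /\ rank a <= n.
Proof.
rewrite /smem; split=> [h|[Pa an]].
  have := (stage_mem_raises_to (rep_minimal a) (@denoteP n.+1 _)).2 h.
  move=> /= [c [b Pb bc] ac].
  by rewrite (raises_to_uniq ac bc) (raises_to_leq bc).
apply: (stage_mem_raises_to (rep_minimal a) (@denoteP n.+1 _)).1 => /=.
by have [c ac] := raises_to_ex (rep a) an; exists c => //; exists a.
Qed.

Lemma rank_setof n (P : set (superstr X)) : rank (setof n P) <= n.+1.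
Proof. exact: raises_to_leq (@denoteP n.+1 _). Qed.

Lemma mem_upair (a b c : superstr X) : smem c (upair a b) <-> c = a \/ c = b.
Proof.
rewrite /upair mem_setof; split=> [[]//|cab]; split=> //.
by case: cab => ->; rewrite leq_max leqnn ?orbT.
Qed.

Lemma opair_inj (a b c d : superstr X) :
  opair a b = opair c d -> a = c /\ b = d.
Proof.
have upl (x y : superstr X) : smem x (upair x y) by apply/mem_upair; left.
have upr (x y : superstr X) : smem y (upair x y) by apply/mem_upair; right.
have up1 (x y z : superstr X) : upair x x = upair y z -> x = y /\ x = z.
  by move=> e; split; [have := upl y z|have := upr y z];
    rewrite -e => /mem_upair[].
have up2 (x y z : superstr X) : upair x y = upair x z -> y = z.
  move=> e; have := upr x z; rewrite -e => /mem_upair[zx|//].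
  by subst z; have := upr x y; rewrite e => /mem_upair[].
move=> e.
have eac : a = c.
  have := upl (upair c c) (upair c d).
  rewrite -[upair (upair _ _) _]/(opair c d) -e => /mem_upair[/up1[]//|].
  by move=> /up1[].
by subst c; split=> //; exact: up2 (up2 _ _ _ e).
Qed.

Lemma atom_inj : injective (@atom X).
Proof.
move=> x y e; have := congr1 (fun a => Tagged (stage X) (rep a)) e.
exact: eq_from_Tagged.
Qed.

Lemma mem_atom (a : superstr X) (x : X) : ~ smem a (atom x).
Proof. by []. Qed.

Lemma mem_atoms (a : superstr X) (A : set X) :
  smem a (atoms A) <-> exists2 x, A x & a = atom x.
Proof.
split=> [[x Ax ax]|[x Ax ->]]; exists x => //; last exact: raises_to_refl.
exact: (@raises_to_rep a (atom x)).
Qed.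

Lemma ext_superstr (a b : superstr X) : 0 < rank a -> 0 < rank b ->
  (forall c, smem c a <-> smem c b) -> a = b.
Proof.
have atomN n (x : stage X n.+1) : minimal x -> exists A, x = inr A.
  case: x => [y|A _]; last by exists A.
  by case; elim: n => [|n [z e]]; [exists y|exists (inl y)].
move=> a0 b0 e; pose k := maxn (rank a) (rank b).
have [x ax] := raises_to_ex (rep a) (leq_maxl (rank a) (rank b)).
have [y bx] := raises_to_ex (rep b) (leq_maxr (rank a) (rank b)).
suff exy : x = y by apply: (@raises_to_uniq a b _ y) => //; rewrite -exy.
have isset (c : superstr X) n (z : stage X n) : 0 < rank c ->
    raises_to (rep c) z -> exists n' (A : set (stage X n')),
    Tagged (stage X) z = Tagged (stage X) (inr A : stage X n'.+1).
  case: c => [[//|m] w mw] /= _; elim=> [|l w' _ [n' [A e']]].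
    by have [A ->] := atomN _ _ mw; exists m, A.
  have el : l = n'.+1 by have := congr1 tag e'.
  by subst l; rewrite (eq_from_Tagged e') /=; exists n'.+1, (@raise X n' @` A).
have h c : stage_mem (rep c) x <-> stage_mem (rep c) y.
  rewrite (stage_mem_raises_to (rep_minimal c) ax).
  by rewrite (stage_mem_raises_to (rep_minimal c) bx); exact: e.
move: (isset _ _ _ a0 ax) (isset _ _ _ b0 bx) => {ax bx}.
move: x y h; rewrite -/k; case: k => [|k] x y h [n [A eA]] [m [B eB]].
  by have := congr1 tag eA.
have en : k = n by have := congr1 tag eA => -[].
have em : k = m by have := congr1 tag eB => -[].
subst n m; move: h; rewrite (eq_from_Tagged eA) (eq_from_Tagged eB) /= => h.
congr inr; apply/seteqP.
have sub (C D : set (stage X k)) : (forall c : superstr X,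
    (exists2 d, C d & raises_to (rep c) d) ->
    (exists2 d, D d & raises_to (rep c) d)) -> C `<=` D.
  move=> CD z Cz; have [|d Dd zd] := CD (denote z).
    by exists z => //; exact: denoteP.
  by rewrite (raises_to_fun (denoteP z) zd).
by split; apply: sub => c; apply (h c).
Qed.

End Adequacy.

(** * Bounded formulas *)

(** Formulas of the language of set theory all of whose quantifiers are bounded.
    Variables are de Bruijn indices: [BAll i phi] is "for all x in v_i, phi",
    where in [phi] index 0 is x and the index j.+1 is the former v_j. *)
Inductive bformula : Type :=
| BEq of nat & nat
| BMem of nat & nat
| BNot of bformula
| BAnd of bformula & bformula
| BOr of bformula & bformula
| BImp of bformula & bformula
| BAll of nat & bformula
| BEx of nat & bformula.

Definition push (T : Type) (a : T) (e : nat -> T) : nat -> T :=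
  fun i => if i is j.+1 then e j else a.

Fixpoint sat (X : Type) (e : nat -> superstr X) (phi : bformula) : Prop :=
  match phi with
  | BEq i j => e i = e j
  | BMem i j => smem (e i) (e j)
  | BNot p => ~ sat e p
  | BAnd p q => sat e p /\ sat e q
  | BOr p q => sat e p \/ sat e q
  | BImp p q => sat e p -> sat e q
  | BAll i p => forall a, smem a (e i) -> sat (push a e) p
  | BEx i p => exists2 a, smem a (e i) & sat (push a e) p
  end.

(** * Nonstandard extensions and enlargements of V(N) *)

(** [Y] is the set *N; [incl] is the inclusion of N in *N. *)
Record nonstandard_extension (Y : Type) (incl : nat -> Y)
    (star : superstr nat -> superstr Y) : Prop := {
  incl_inj : injective incl;
  star_atom : forall n : nat, star (atom n) = atom (incl n);
  star_nat : star (atoms [set: nat]) = atoms [set: Y];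
  star_rank : forall a : superstr nat, rank (star a) = rank a;
  star_transfer : forall (phi : bformula) (e : nat -> superstr nat),
    sat e phi <-> sat (star \o e) phi }.

Definition holds (X : Type) (r a b : superstr X) : Prop := smem (opair a b) r.

Definition is_relation (X : Type) (r : superstr X) : Prop :=
  0 < rank r /\ forall p, smem p r -> exists a b, p = opair a b.

Definition sdomain (X : Type) (r : superstr X) : set (superstr X) :=
  [set a | exists b, holds r a b].

Definition concurrent (X : Type) (r : superstr X) : Prop :=
  is_relation r /\
  forall (k : nat) (a : 'I_k -> superstr X), (forall i, sdomain r (a i)) ->
    exists b, forall i, holds r (a i) b.

Definition enlargement (Y : Type) (incl : nat -> Y)
    (star : superstr nat -> superstr Y) : Prop :=
  nonstandard_extension incl star /\
  forall r : superstr nat, concurrent r ->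
    exists x : superstr Y, forall a, sdomain r a -> holds (star r) (star a) x.

(** * Divisibility *)

(** The relation {(m, n) | m divides n} as an object of V(N); a pair of atoms has
    rank 2. *)
Definition divides : superstr nat :=
  setof 2 [set p | exists m n : nat, m %| n /\ p = opair (atom m) (atom n)].

Definition star_divides (Y : Type) (star : superstr nat -> superstr Y)
  (x y : Y) : Prop := holds (star divides) (atom x) (atom y).

(** v(x) = {S | x \in *S}. *)
Definition ultra (Y : Type) (star : superstr nat -> superstr Y) (x : Y) :
    set_system nat :=
  [set S | smem (atom x) (star (atoms S))].

Definition upward (A : set nat) : set nat :=
  [set n | exists2 a, A a & a %| n].

Definition upward_closed : set_system nat := [set A | upward A = A].

Definition tilde_divides (F G : set_system nat) : Prop :=
  F `&` upward_closed `<=` G.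

Lemma dividesP (m n : nat) : holds divides (atom m) (atom n) <-> m %| n.
Proof.
rewrite /holds mem_setof; split=> [[[m' [n' [d e]]] _]|d].
  by have [em en] := opair_inj e; rewrite (atom_inj em) (atom_inj en).
split; first by exists m, n.
apply: leq_trans (rank_setof _ _) _; rewrite ltnS geq_max.
by rewrite !(leq_trans (rank_setof _ _)).
Qed.

(* Main.v *)
(** If F ~| G, the sets {(m, n) : m in A, n in B, m | n} with A in F and B in G
    have the finite intersection property: the upward closure of A is an upward
    closed set of F, so it belongs to G and meets B.  In an enlargement some pair
    (x, y) belongs to all their extensions, whence v(x) = F, v(y) = G and x *| y.
    Conversely, by transfer, x in *A and x *| y give y in *A for every upward
    closed A.  An enlargement is obtained as the Mostowski collapse of a bounded
    ultrapower of V(N). *)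
Require Import Defs.
From Stdlib Require List.
From mathcomp Require Import all_boot.
From mathcomp Require Import all_classical.

Set Implicit Arguments.
Unset Strict Implicit.
Unset Printing Implicit Defensive.

Local Open Scope classical_set_scope.

(** * Bounded formulas describing ordered pairs *)

Lemma smem_rank (X : Type) (a b : superstr X) : smem a b -> rank a < rank b.
Proof.
by case: b => [[//|n] [//|B] mb] [c _ /raises_to_leq].
Qed.

Definition fupair (u a b : nat) : bformula :=
  BAnd (BAnd (BMem a u) (BMem b u)) (BAll u (BOr (BEq 0 a.+1) (BEq 0 b.+1))).

(** Both unordered pairs that make up a Kuratowski pair are elements of it, so the two quantifiers
    can be bounded by the pair itself. *)
Definition fopair (p a b : nat) : bformula :=
  BEx p (BEx p.+1 (BAnd (BAnd (fupair 1 a.+2 a.+2) (fupair 0 a.+2 b.+2))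
                        (fupair p.+2 1 0))).

Lemma sat_fupair (X : Type) (e : nat -> superstr X) u a b :
  sat e (fupair u a b) <-> e u = upair (e a) (e b).
Proof.
split=> [/= [[au bu] uab]|/= ->]; last first.
  split=> [|c /mem_upair//].
  by split; apply/mem_upair; [left|right].
(* Extensionality needs positive ranks: each side has an element, hence is not an atom. *)
have mab : smem (e a) (upair (e a) (e b)) by apply/mem_upair; left.
apply: ext_superstr => [||c].
- exact: leq_ltn_trans (leq0n _) (smem_rank au).
- exact: leq_ltn_trans (leq0n _) (smem_rank mab).
- by rewrite mem_upair; split=> [/uab//|[]->].
Qed.

Lemma sat_fopair (X : Type) (e : nat -> superstr X) p a b :
  sat e (fopair p a b) <-> e p = opair (e a) (e b).
Proof.
split=> [|epab].
  move=> [u _ [w _ [[uE wE] pE]]]; set e' := push w (push u e).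
  have /= {}uE := (sat_fupair e' 1 a.+2 a.+2).1 uE.
  have /= {}wE := (sat_fupair e' 0 a.+2 b.+2).1 wE.
  by have /= -> := (sat_fupair e' p.+2 1 0).1 pE; rewrite uE wE.
have mu : smem (upair (e a) (e a)) (e p).
  by rewrite epab; apply/mem_upair; left.
have mw : smem (upair (e a) (e b)) (e p).
  by rewrite epab; apply/mem_upair; right.
by exists (upair (e a) (e a)) => //; exists (upair (e a) (e b)) => //;
  split; [split|]; apply/sat_fupair.
Qed.

Opaque fopair.

Lemma mem_opair (X : Type) (a b : superstr X) :
  smem (upair a b) (opair a b).
Proof. by apply/mem_upair; right. Qed.

Lemma rank_upair (X : Type) (a b : superstr X) n :
  rank a <= n -> rank b <= n -> rank (upair a b) <= n.+1.
Proof.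
by move=> an bn; apply: leq_trans (rank_setof _ _) _; rewrite ltnS geq_max an.
Qed.

Lemma rank_opair (X : Type) (a b : superstr X) n :
  rank a <= n -> rank b <= n -> rank (opair a b) <= n.+2.
Proof. by move=> an bn; do 2!apply: rank_upair => //; exact: rank_upair. Qed.

(** * Consequences of transfer *)

Section Transfer.
Variables (Y : Type) (incl : nat -> Y) (star : superstr nat -> superstr Y).
Hypothesis ext : nonstandard_extension incl star.

Lemma transfer (s : seq (superstr nat)) (phi : bformula) :
  let e := nth (atom 0) s in sat e phi -> sat (star \o e) phi.
Proof. by move=> e; apply (star_transfer ext). Qed.

Lemma star_atoms_disjoint (A B : set nat) (a : superstr Y) :
  (forall n, A n -> ~ B n) ->
  smem a (star (atoms A)) -> ~ smem a (star (atoms B)).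
Proof.
move=> AB.
suff /transfer/(_ a)/= : sat (nth (atom 0) [:: atoms A; atoms B])
  (BAll 0 (BNot (BMem 0 2))) by apply.
move=> b /= /mem_atoms[n An bn] /mem_atoms[m Bm bm].
by apply: (AB n An); rewrite (@atom_inj _ n m) // -bn.
Qed.

(** The second component of a pair in [r] is an element of an unordered pair inside it, so the
    hypothesis becomes a bounded formula in [r] and [a], which transfers. *)
Lemma star_holds_mem (r a : superstr nat) (x : superstr Y) :
  (forall b, holds r a b -> smem b a) ->
  holds (star r) (star a) x -> smem x (star a).
Proof.
move=> ra rax.
suff /transfer/(_ _ rax _ (mem_opair _ _) x)/= : sat (nth (atom 0) [:: r; a])
    (BAll 0 (BAll 0 (BAll 0 (BImp (fopair 2 4 0) (BMem 0 4))))).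
  by apply; [apply/mem_upair; right|apply/sat_fopair].
move=> /= q rq u _ b _ /sat_fopair/= qE.
by apply: ra; rewrite /holds -qE.
Qed.

(** Both components of a pair lie in its second unordered pair, so the upward closedness of [A] is a
    bounded statement about [divides] and [A]. *)
Lemma star_divides_upward (A : set nat) (x y : Y) : upward_closed A ->
  star_divides star x y -> ultra star x A -> ultra star y A.
Proof.
move=> uA xy xA.
suff /transfer/(_ _ xy _ (mem_opair _ _) (atom x))/= :
    sat (nth (atom 0) [:: divides; atoms A])
    (BAll 0 (BAll 0 (BAll 0 (BAll 1
      (BImp (BAnd (fopair 3 1 0) (BMem 1 5)) (BMem 0 5)))))).
  move=> /(_ _ (atom y)); apply; try by apply/mem_upair; auto.
  by split=> //; apply/sat_fopair.
move=> /= p dp u _ m _ n _ [/sat_fopair/= pE /mem_atoms[k Ak mE]].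
have [[k' [l [kl pE']]] _] := (mem_setof _ _ _).1 dp.
have [mk' nl] := opair_inj (etrans (esym pE) pE').
apply/mem_atoms; exists l => //; rewrite -uA; exists k => //.
by rewrite (@atom_inj _ k k') // -mE.
Qed.

Definition divides_in (A B : set nat) : superstr nat :=
  setof 2 [set p | exists m n : nat,
    [/\ A m, B n, m %| n & p = opair (atom m) (atom n)]].

Lemma mem_divides_in (A B : set nat) m n :
  A m -> B n -> m %| n -> smem (opair (atom m) (atom n)) (divides_in A B).
Proof.
move=> Am Bn mn; apply/mem_setof; split; first by exists m, n.
exact: rank_opair.
Qed.

Lemma mem_star_divides_in (A B : set nat) (p : superstr Y) :
  smem p (star (divides_in A B)) -> exists x y : Y,
    [/\ p = opair (atom x) (atom y), star_divides star x y,
        ultra star x A & ultra star y B].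
Proof.
move=> pD.
(* The components are bounded by [atoms [set: nat]], whose extension is [atoms [set: Y]]; hence they
   are again atoms. *)
suff /transfer/(_ p pD)/= : sat
    (nth (atom 0) [:: divides_in A B; atoms [set: nat]; atoms A; atoms B; divides])
    (BAll 0 (BEx 2 (BEx 3 (BAnd (BAnd (fopair 2 1 0) (BMem 2 7))
                                (BAnd (BMem 1 5) (BMem 0 6)))))).
  have atomY (a : superstr Y) : smem a (star (atoms [set: nat])) ->
      exists x, a = atom x.
    by rewrite (star_nat ext) => /mem_atoms[x _ ->]; exists x.
  move=> [_ /atomY[x ->] [_ /atomY[y ->]]].
  move=> [[/sat_fopair/= pE pd] [xA yB]]; exists x, y.
  by split=> //; rewrite /star_divides /holds -pE.
move=> /= q /mem_setof[[m [n [Am Bn mn ->]]] _].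
exists (atom m); first by apply/mem_atoms; exists m.
exists (atom n); first by apply/mem_atoms; exists n.
split; split; first exact/sat_fopair.
- exact/dividesP.
- by apply/mem_atoms; exists m.
- by apply/mem_atoms; exists n.
Qed.

End Transfer.

(** * The finite intersection property in enlargements *)

(** Membership restricted to sets in [P] is concurrent by the finite intersection hypothesis, and
    the common rank bound makes it an object of the superstructure. *)
Lemma enlargement_fip (Y : Type) (incl : nat -> Y)
    (star : superstr nat -> superstr Y) n (P : set (superstr nat)) :
  enlargement incl star -> (forall a, P a -> rank a <= n) ->
  (forall k (a : 'I_k -> superstr nat), (forall i, P (a i)) ->
     exists b, forall i, smem b (a i)) ->
  exists x, forall a, P a -> smem x (star a).
Proof.
move=> [ext enl] Pn fip.
have Pne a : P a -> exists b, smem b a.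
  move=> Pa; have [|b h] := fip 1 (fun=> a); first by [].
  by exists b; exact: h ord0.
(* The empty family is split off: otherwise a member supplies an element of [r], hence positive
   rank. *)
have [[a0 Pa0]|noP] := pselect (exists a, P a); last first.
  by exists (star (atom 0)) => a Pa; case: noP; exists a.
(* Pairs of objects of rank at most [n] have rank at most [n.+2], so [setof] drops none of them. *)
pose r := setof n.+2 [set q | exists a b : superstr nat,
  [/\ P a, smem b a & q = opair a b]].
have rE a b : holds r a b <-> P a /\ smem b a.
  rewrite /holds mem_setof; split=> [[[a' [b' [Pa ba]]]]|[Pa ba]].
    by move=> /opair_inj[-> ->].
  split; first by exists a, b.
  have an := Pn _ Pa; apply: rank_opair => //.
  exact: leq_trans (ltnW (smem_rank ba)) an.
have [|x xr] := enl r.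
  split.
    split=> [|p /mem_setof[[a [b [_ _ ->]]] _]]; last by exists a, b.
    have [b0 b0a] := Pne _ Pa0.
    have /smem_rank : holds r a0 b0 by apply/rE.
    exact: leq_ltn_trans.
  move=> k a ra; have [|b ba] := fip k a.
    by move=> i; have [b /rE[]] := ra i.
  by exists b => i; apply/rE; split=> //; have [b' /rE[]] := ra i.
exists x => a Pa; apply: (star_holds_mem ext (r := r)) => [b /rE[]//|].
by apply: xr; have [b ba] := Pne _ Pa; exists b; apply/rE.
Qed.

Lemma tilde_divides_star (F G : set_system nat) (Y : Type) (incl : nat -> Y)
    (star : superstr nat -> superstr Y) :
  UltraFilter F -> UltraFilter G -> tilde_divides F G -> enlargement incl star ->
  exists x y : Y, ultra star x = F /\ ultra star y = G /\ star_divides star x y.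
Proof.
move=> hF hG FG enl; have ext := enl.1.
have [||p pD] := @enlargement_fip _ _ _ 3
    [set D | exists A B, [/\ F A, G B & D = divides_in A B]] enl.
- by move=> _ [A [B [_ _ ->]]]; exact: rank_setof.
- move=> k D /choice[A /choice[B AB]].
  have FA : F [set m | forall i, A i m].
    by apply: filter_forall => i; have [] := AB i.
  have GB : G [set n | forall i, B i n].
    by apply: filter_forall => i; have [] := AB i.
  have Gup : G (upward [set m | forall i, A i m]).
    apply: FG; split.
      by apply: filterS FA => m Am; exists m.
    apply/seteqP; split=> n; last by exists n.
    by move=> [m [l Al lm] mn]; exists l => //; exact: dvdn_trans mn.
  have [n [Bn [m Am mn]]] := filter_ex (filterI GB Gup).
  exists (opair (atom m) (atom n)) => i.
  by have [_ _ ->] := AB i; exact: mem_divides_in.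
have pAB A B : F A -> G B -> smem p (star (divides_in A B)).
  by move=> FA GB; apply: pD; exists A, B.
(* Taking both sets to be all of N yields the components of [p]; injectivity of pairs identifies
   them with those found for any other sets. *)
have [x [y [pxy xy _ _]]] :=
  mem_star_divides_in ext (pAB _ _ filterT filterT).
(* One inclusion suffices: a set in [ultra star z] but not in [H] has its complement in [H], hence
   in [ultra star z], against disjointness. *)
have ultraE H z : UltraFilter H -> H `<=` ultra star z -> ultra star z = H.
  move=> hH Hz; apply/seteqP; split=> // S zS.
  have [//|/Hz zSc] := in_ultra_setVsetC S hH.
  by case: (star_atoms_disjoint ext (A := S) (B := ~` S) _ zS zSc) => n Sn; apply.
exists x, y; split; [|split=> //]; apply: ultraE => A HA.
  have [x' [y' [e _ + _]]] := mem_star_divides_in ext (pAB _ _ HA filterT).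
  by have [/(@atom_inj Y x x') -> _] := opair_inj (etrans (esym pxy) e).
have [x' [y' [e _ _ +]]] := mem_star_divides_in ext (pAB _ _ filterT HA).
by have [_ /(@atom_inj Y y y') ->] := opair_inj (etrans (esym pxy) e).
Qed.

(** * The bounded ultrapower and its Mostowski collapse *)

Section Ultrapower.
Variables (I : Type) (U : set_system I).
Hypothesis ultraU : UltraFilter U.

Lemma ultra_not (A : set I) : U (~` A) <-> ~ U A.
Proof.
split=> [nA UA|nA].
  by have [i []] := filter_ex (filterI nA UA).
by have [] := in_ultra_setVsetC A ultraU.
Qed.

Lemma ultra_choice (T : Type) (t0 : T) (P : I -> T -> Prop) :
  U [set i | exists t, P i t] -> exists f : I -> T, U [set i | P i (f i)].
Proof.
move=> UP.
have /choice[f fP] : forall i, exists t, (exists t', P i t') -> P i t.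
  move=> i; have [[t Pt]|nP] := pselect (exists t, P i t); first by exists t.
  by exists t0.
by exists f; apply: filterS UP => i /= /fP.
Qed.

(** If the inclusion failed on a set of [U], counterexamples chosen there would form a family
    violating the hypothesis. Inclusion of internal sets is thus tested on their internal
    elements. *)
Lemma ultra_subset (T : Type) (t0 : T) (A B : I -> set T) :
  (forall f : I -> T, U [set i | A i (f i)] -> U [set i | B i (f i)]) ->
  U [set i | A i `<=` B i].
Proof.
move=> AB; apply: contrapT => /ultra_not nAB.
have [|f fAB] := @ultra_choice T t0 (fun i t => A i t /\ ~ B i t).
  by apply: filterS nAB => i /= /existsNP[t /not_implyP]; exists t.
have /AB fB : U [set i | A i (f i)] by apply: filterS fAB => i [].
by have [i [[_ nB] /nB]] := filter_ex (filterI fAB fB).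
Qed.

Definition ueq (T : Type) (f g : I -> T) : Prop := U [set i | f i = g i].

(** The ultrapower of N modulo [U]; its points are the classes themselves, so that equality is
    Leibniz equality. *)
Definition upower : Type :=
  {C : set (I -> nat) | exists f, C = [set g | ueq f g]}.

Definition class (f : I -> nat) : upower :=
  exist _ [set g | ueq f g] (ex_intro _ f erefl).

Lemma class_eq (f g : I -> nat) : class f = class g <-> ueq f g.
Proof.
split=> [/(congr1 sval)/= fg|fg].
  have : [set h | ueq g h] g by exact: filterE.
  by rewrite -fg.
apply: eq_exist; apply/seteqP; split=> h /=; apply: filterS2 fg => i /=.
  by move=> ->.
by move=> ->.
Qed.

Lemma class_surj (x : upower) : exists f, x = class f.
Proof.
case: x => C [f fC]; exists f.
by apply: eq_exist.
Qed.

(** The Mostowski collapse of the internal object represented by [f]. *)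
Fixpoint col (n : nat) : (I -> stage nat n) -> stage upower n :=
  match n with
  | 0 => class
  | n'.+1 => fun f =>
      match pselect (exists a : I -> nat, U [set i | f i = inl (a i)]) with
      | left h => inl (class (sval (cid h)))
      | right _ => inr [set c | exists2 g : I -> stage nat n',
          U [set i | exists2 B, f i = inr B & B (g i)] & c = col g]
      end
  end.

Definition stage0 n : stage nat n := if n is n'.+1 then inl 0 else 0.

Lemma stage_ultra n (f : I -> stage nat n.+1) :
  (exists a : I -> nat, ueq f (fun i => inl (a i))) \/
  (exists B : I -> set (stage nat n), ueq f (fun i => inr (B i))).
Proof.
have [UA|UA] := in_ultra_setVsetC [set i | exists a, f i = inl a] ultraU.
  by left; exact: (@ultra_choice _ 0 (fun i a => f i = inl a)).
right; apply: (@ultra_choice _ set0 (fun i B => f i = inr B)); apply: filterS UA => i /=.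
by case: (f i) => [a []|B _]; [exists a|exists B].
Qed.

Lemma col_inl n (f : I -> stage nat n.+1) (a : I -> nat) :
  ueq f (fun i => inl (a i)) -> col f = inl (class a).
Proof.
move=> fa /=; case: pselect => [h|[]]; last by exists a.
case: cid => b /= fb; congr inl; apply/class_eq.
by apply: filterS2 fa fb => i /= -> [].
Qed.

Lemma col_inr n (f : I -> stage nat n.+1) (B : I -> set (stage nat n)) :
  ueq f (fun i => inr (B i)) ->
  col f = inr [set c | exists2 g, U [set i | B i (g i)] & c = col g].
Proof.
move=> fB /=; case: pselect => [[a fa]|_].
  by have [i [/= -> ]] := filter_ex (filterI fa fB).
congr inr; apply/seteqP; split=> c [g gB ->]; exists g => //.
  by apply: filterS2 fB gB => i /= -> [B' [->]].
by apply: filterS2 fB gB => i /= -> gB; exists (B i).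
Qed.

(** Induction on the stage: internal sets with the same collapsed elements include each other on a
    set of [U], the induction hypothesis making the choice of representing families immaterial. *)
Lemma col_eq n (f g : I -> stage nat n) : col f = col g <-> ueq f g.
Proof.
elim: n f g => [|n IH] f g; first exact: class_eq.
have sub (A B : I -> set (stage nat n)) :
    [set c | exists2 g, U [set i | A i (g i)] & c = col g] `<=`
    [set c | exists2 g, U [set i | B i (g i)] & c = col g] ->
    U [set i | A i `<=` B i].
  move=> AB; apply: (ultra_subset (stage0 n)) => h hA.
  have [|h' h'B /IH hh'] := AB (col h); first by exists h.
  by apply: filterS2 h'B hh' => i /= ? ->.
have [[a fa]|[A fA]] := stage_ultra f; have [[b gb]|[B gB]] := stage_ultra g.
- rewrite (col_inl fa) (col_inl gb); split=> [/(@inl_inj upower _)/class_eq ab|fg].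
    by apply: filterS3 fa gb ab => i /= -> -> ->.
  congr inl; apply/class_eq.
  by apply: filterS3 fa gb fg => i /= -> -> [].
- rewrite (col_inl fa) (col_inr gB); split=> // fg.
  by have [i [[/= -> ->]]] := filter_ex (filterI (filterI fa gB) fg).
- rewrite (col_inr fA) (col_inl gb); split=> // fg.
  by have [i [[/= -> ->]]] := filter_ex (filterI (filterI fA gb) fg).
rewrite (col_inr fA) (col_inr gB); split=> [[AB]|fg].
  have AsubB : U [set i | A i `<=` B i] by apply: sub; rewrite AB.
  have BsubA : U [set i | B i `<=` A i] by apply: sub; rewrite -AB.
  have UAB : U [set i | A i = B i].
    by apply: filterS2 AsubB BsubA => i /= *; apply/seteqP.
  by apply: filterS3 fA gB UAB => i /= -> -> ->.
have UAB : U [set i | A i = B i].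
  by apply: filterS3 fA gB fg => i /= -> -> [].
congr inr; apply/seteqP; split=> c [h hP ->]; exists h => //;
  by apply: filterS2 UAB hP => i /= ->.
Qed.

Lemma mem_col n (f : I -> stage nat n) (g : I -> stage nat n.+1) :
  (exists2 B, col g = inr B & B (col f)) <->
  U [set i | exists2 B, g i = inr B & B (f i)].
Proof.
split=> [[C gC Cf]|fg].
  have [[a ga]|[B gB]] := stage_ultra g; first by rewrite (col_inl ga) in gC.
  move: gC Cf; rewrite (col_inr gB) => -[<-] [h hB /col_eq fh].
  by apply: filterS3 gB hB fh => i /= -> ? ->; exists (B i).
have [[a ga]|[B gB]] := stage_ultra g.
  by have [i [/= -> [B]]] := filter_ex (filterI ga fg).
rewrite (col_inr gB); exists [set c | exists2 h, U [set i | B i (h i)] & c = col h] => //.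
exists f => //.
by apply: filterS2 gB fg => i /= -> [B' [->]].
Qed.

Lemma col_raise n (f : I -> stage nat n) :
  col (fun i => raise (f i)) = raise (col f).
Proof.
elim: n f => [|n IH] f; first by rewrite (@col_inl 0 _ f) //; exact: filterE.
have [[a fa]|[B fB]] := stage_ultra f.
  rewrite (col_inl fa) (@col_inl n.+1 _ a) //.
  by apply: filterS fa => i /= ->.
rewrite (col_inr fB) (@col_inr n.+1 _ (fun i => @raise nat n @` B i)); last first.
  by apply: filterS fB => i /= ->.
congr inr; apply/seteqP; split=> c.
  move=> [g gB ->].
  (* A family of raised elements is lifted to a family of preimages, chosen on a set of [U]. *)
  have [|h hB] := @ultra_choice _ (stage0 n) (fun i t => B i t /\ raise t = g i).
    by apply: filterS gB => i [t Bt tg]; exists t.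
  exists (col h); first by exists h => //; apply: filterS hB => i [].
  apply: etrans (esym (IH h)) _.
  by apply/col_eq; apply: filterS hB => i [].
move=> [_ [h hB ->] <-]; exists (fun i => raise (h i)) => //.
by apply: filterS hB => i /= Bh; exists (h i).
Qed.

(** This is why the collapse preserves minimality, and with it the rank. *)
Lemma col_raised n (f : I -> stage nat n.+1) (y : stage upower n) :
  col f = raise y -> exists g : I -> stage nat n, ueq f (fun i => raise (g i)).
Proof.
elim: n f y => [|n IH] f y.
  have [[a fa] _|[B fB]] := stage_ultra f; first by exists a.
  by rewrite (col_inr fB).
have [[a fa] _|[B fB]] := stage_ultra f; first by exists (fun i => inl (a i)).
rewrite (col_inr fB); case: y => [//|A] [BA].
(* By induction every internal element comes from the lower stage, so almost every [B i] consists of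
   raised elements and can be replaced by its preimage. *)
have Braise : U [set i | B i `<=` range (@raise nat n)].
  apply: (ultra_subset (stage0 n.+1)) => h hB.
  have : (@raise _ n @` A) (col h) by rewrite -BA; exists h.
  move=> [y _ /esym/IH[g hg]].
  by apply: filterS hg => i /= ->; exists (g i).
exists (fun i => inr (@raise nat n @^-1` B i)).
apply: filterS2 fB Braise => i /= -> BR; congr inr; apply/seteqP; split=> c.
  by move=> Bc; have [t _ tc] := BR c Bc; exists t; rewrite //= tc.
by move=> [t Bt <-].
Qed.

Lemma col_minimal n (f : I -> stage nat n) :
  U [set i | minimal (f i)] -> minimal (col f).
Proof.
case: n f => [//|n] f mf [y /col_raised[g fg]].
have [i [/= mfi fgi]] := filter_ex (filterI mf fg).
by apply: mfi; exists (g i).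
Qed.

Lemma col_raises_to m n (f : I -> stage nat m) (g : I -> stage nat n) :
  (forall i, raises_to (f i) (g i)) -> raises_to (col f) (col g).
Proof.
move=> fg; have mn : m <= n.
  (* Members of a proper filter are nonempty, so an index exists at which the stages can be
     compared. *)
  have [i _] := filter_ex (@filterT _ U _).
  exact: raises_to_leq (fg i).
elim: n mn g fg => [|n IH].
  rewrite leqn0 => /eqP m0; subst m => g fg.
  rewrite (_ : g = f); first exact: raises_to_refl.
  by apply/funext => i; exact: raises_to_fun (fg i) (raises_to_refl _).
rewrite leq_eqVlt => /orP[/eqP mn|mn] g fg.
  subst m; rewrite (_ : g = f); first exact: raises_to_refl.
  by apply/funext => i; exact: raises_to_fun (fg i) (raises_to_refl _).
have /choice[h fh] : forall i, exists c : stage nat n, raises_to (f i) c.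
  by move=> i; exact: raises_to_ex.
rewrite (_ : g = fun i => raise (h i)).
  by rewrite col_raise; apply: raises_to_step; exact: IH.
apply/funext => i; apply: raises_to_fun (fg i) _.
exact: raises_to_step.
Qed.

(** [a] is the internal object represented by the family [f]; the common stage
    [n] bounds the ranks of the [f i]. *)
Definition represents (f : I -> superstr nat) (a : superstr upower) : Prop :=
  exists n (g : I -> stage nat n),
    (forall i, raises_to (rep (f i)) (g i)) /\ raises_to (rep a) (col g).

(** * Represented families and Łoś's theorem *)

Lemma represents_lift (f : I -> superstr nat) (a : superstr upower) :
  represents f a -> exists n0, forall n, n0 <= n -> exists g : I -> stage nat n,
    (forall i, raises_to (rep (f i)) (g i)) /\ raises_to (rep a) (col g).
Proof.
move=> [m [g [fg ag]]]; exists m => n mn.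
have /choice[h gh] : forall i, exists c : stage nat n, raises_to (g i) c.
  by move=> i; exact: raises_to_ex.
exists h; split=> [i|]; first exact: raises_to_trans (fg i) (gh i).
exact: raises_to_trans ag (col_raises_to gh).
Qed.

Lemma represents_col n (g : I -> stage nat n) :
  represents (fun i => denote (g i)) (denote (col g)).
Proof. by exists n, g; split=> [i|]; exact: denoteP. Qed.

Lemma represents_eq (f g : I -> superstr nat) (a b : superstr upower) :
  represents f a -> represents g b -> a = b <-> ueq f g.
Proof.
move=> /represents_lift[m fa] /represents_lift[n gb].
have [f' [ff' af']] := fa _ (leq_maxl m n).
have [g' [gg' bg']] := gb _ (leq_maxr m n).
split=> [ab|fg].
  subst b; have /col_eq fg' := raises_to_fun af' bg'.
  apply: filterS fg' => i /= e.
  by apply: raises_to_uniq (ff' i) _; rewrite e.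
have /col_eq e : ueq f' g'.
  apply: filterS fg => i /= e; apply: raises_to_fun (ff' i) _.
  by rewrite e.
by apply: raises_to_uniq af' _; rewrite e.
Qed.

Lemma smem_stage (X : Type) (a b : superstr X) n (x : stage X n)
    (y : stage X n.+1) : raises_to (rep a) x -> raises_to (rep b) y ->
  smem a b <-> exists2 B, y = inr B & B x.
Proof.
move=> ax yb; rewrite /smem -(stage_mem_raises_to (rep_minimal a) yb) /=.
split=> [|[B -> Bx]]; last by exists x.
case: (y) => [//|B] [c Bc ac]; exists B => //.
by rewrite (raises_to_fun ax ac).
Qed.

Lemma represents_mem (f g : I -> superstr nat) (a b : superstr upower) :
  represents f a -> represents g b -> smem a b <-> U [set i | smem (f i) (g i)].
Proof.
move=> /represents_lift[m fa] /represents_lift[n gb].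
have [f' [ff' af']] := fa _ (leq_maxl m n).
have [g' [gg' bg']] := gb _ (leqW (leq_maxr m n)).
rewrite (smem_stage af' bg') mem_col.
by split; apply: filterS => i /=; apply (smem_stage (ff' i) (gg' i)).
Qed.

Lemma represents_stage (g : I -> superstr nat) (b : superstr upower) :
  represents g b -> exists n (g' : I -> stage nat n.+1),
    (forall i, raises_to (rep (g i)) (g' i)) /\ raises_to (rep b) (col g').
Proof. by move=> /represents_lift[n] /(_ n.+1 (leqnSn n)); exists n. Qed.

(** Transitivity of the collapse: elements of internal sets are internal. *)
Lemma mem_represents (g : I -> superstr nat) (a b : superstr upower) :
  represents g b -> smem a b -> exists f, represents f a.
Proof.
move=> /represents_stage[n [g' [gg' bg']]].
rewrite /smem -(stage_mem_raises_to (rep_minimal a) bg').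
have [[c /col_inl ->]//|[B /col_inr ->]] := stage_ultra g'.
move=> [_ [h _ ->] ah]; exists (fun i => denote (h i)); exists n, h.
by split=> // i; exact: denoteP.
Qed.

Lemma represents_ex (g : I -> superstr nat) (b : superstr upower)
    (P : I -> superstr nat -> Prop) :
  represents g b -> U [set i | exists2 x, smem x (g i) & P i x] ->
  exists f a, represents f a /\ U [set i | smem (f i) (g i) /\ P i (f i)].
Proof.
move=> /represents_stage[n [g' [gg' bg']]] UP.
(* Witnesses are chosen in the single stage [n], so that the family has bounded rank and can be
   collapsed. *)
have [|h hP] := @ultra_choice _ (stage0 n)
    (fun i c => smem (denote c) (g i) /\ P i (denote c)).
  apply: filterS UP => i [x xg Px].
  move: (xg); rewrite /smem -(stage_mem_raises_to (rep_minimal x) (gg' i)).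
  move=> /=; case: (g' i) => [//|B] [c _ xc]; exists c.
  by rewrite (raises_to_uniq (denoteP c) xc).
exists (fun i => denote (h i)), (denote (col h)).
by split=> //; exact: represents_col.
Qed.

Lemma push_section (f : I -> superstr nat) (ef : nat -> I -> superstr nat) i :
  (fun j => push f ef j i) = push (f i) (fun j => ef j i).
Proof. by apply/funext => -[]. Qed.

Lemma represents_push (f : I -> superstr nat) (a : superstr upower)
    (ef : nat -> I -> superstr nat) (e : nat -> superstr upower) :
  represents f a -> (forall j, represents (ef j) (e j)) ->
  forall j, represents (push f ef j) (push a e j).
Proof. by move=> fa efe []. Qed.

(** Łoś's theorem, by induction on the formula. For bounded quantifiers, [mem_represents] makes
    every element of an internal set internal, and [represents_ex] assembles coordinatewise
    witnesses into an internal one. *)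
Lemma los (phi : bformula) (ef : nat -> I -> superstr nat)
    (e : nat -> superstr upower) : (forall j, represents (ef j) (e j)) ->
  sat e phi <-> U [set i | sat (fun j => ef j i) phi].
Proof.
elim: phi ef e => [j k|j k|p IHp|p IHp q IHq|p IHp q IHq|p IHp q IHq|j p IHp|j p IHp]
  ef e efe /=.
- exact: represents_eq.
- exact: represents_mem.
- by rewrite (IHp _ _ efe) -ultra_not.
- rewrite (IHp _ _ efe) (IHq _ _ efe); split=> [[]|pq]; first exact: filterI.
  by split; apply: filterS pq => i [].
- rewrite (IHp _ _ efe) (IHq _ _ efe); split=> [[]|pq].
  + by apply: filterS => i; left.
  + by apply: filterS => i; right.
  + apply: contrapT => /not_orP[/ultra_not np /ultra_not nq].
    by have [i [[np' nq'] []]] := filter_ex (filterI (filterI np nq) pq).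
- rewrite (IHp _ _ efe) (IHq _ _ efe); split=> [pq|]; last exact: filterS2.
  have [Up|np] := in_ultra_setVsetC [set i | sat (fun j => ef j i) p] ultraU.
    by apply: filterS (pq Up) => i + _.
  by apply: filterS np => i /= np' /np'.
- split=> [sp|Up a /[dup] aj /(mem_represents (efe j))[f fa]].
    (* Coordinatewise counterexamples on a set of [U] would form an internal counterexample. *)
    apply: contrapT => /ultra_not nU.
    have [|f [a [fa fp]]] := @represents_ex _ _
        (fun i x => ~ sat (push x (fun j => ef j i)) p) (efe j).
      apply: filterS nU => i /= /existsNP[x /not_implyP[xj nx]].
      by exists x.
    have aj : smem a (e j).
      by apply/(represents_mem fa (efe j)); apply: filterS fp => i [].
    have /(IHp _ _ (represents_push fa efe)) Up := sp _ aj.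
    have [i [/=]] := filter_ex (filterI Up fp).
    by rewrite push_section => ? [].
  apply/(IHp _ _ (represents_push fa efe)).
  move/(represents_mem fa (efe j)) in aj.
  by apply: filterS2 Up aj => i /= + fj; rewrite push_section; apply.
split=> [[a /[dup] aj /(mem_represents (efe j))[f fa]]|].
  move/(represents_mem fa (efe j)) in aj.
  move=> /(IHp _ _ (represents_push fa efe)) Up.
  by apply: filterS2 aj Up => i /= fj; rewrite push_section; exists (f i).
move=> /(represents_ex (efe j))[f [a [fa fp]]]; exists a.
  by apply/(represents_mem fa (efe j)); apply: filterS fp => i [].
apply/(IHp _ _ (represents_push fa efe)).
by apply: filterS fp => i [_] /=; rewrite push_section.
Qed.

(** * The star map and transfer *)

Lemma star_minimal (a : superstr nat) : minimal (col (fun=> rep a)).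
Proof. by apply: col_minimal; apply: filterE => i; exact: rep_minimal. Qed.

(** The constant family is collapsed in the stage [rank a], where the result is minimal, so ranks
    are preserved by construction. *)
Definition star (a : superstr nat) : superstr upower :=
  Superstr (star_minimal a).

Lemma represents_star (a : superstr nat) : represents (fun=> a) (star a).
Proof.
by exists (rank a), (fun=> rep a); split=> [i|]; exact: raises_to_refl.
Qed.

Lemma star_extension : nonstandard_extension (fun n => class (fun=> n)) star.
Proof.
(* For constant families the index set in Łoś's theorem is everything or empty. *)
have const (P : Prop) : P <-> U (fun=> P).
  by split=> [p|/filter_ex[]//]; exact: filterE.
split=> //.
- by move=> m n /class_eq; rewrite /ueq => /filter_ex[].
- by move=> n; apply: superstr_eq.
- apply: superstr_eq.
  change (Tagged (stage upower) (@col 1 (fun=> inr [set: nat])) =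
          Tagged (stage upower) (inr [set: upower] : stage upower 1)).
  rewrite (@col_inr 0 _ (fun=> setT)); last exact: filterE.
  apply: congr1; congr inr; apply/seteqP; split=> // c _.
  have [f ->] := class_surj c; exists f => //; exact: filterE.
- move=> phi e.
  rewrite (@los _ (fun j _ => e j)); first exact: const.
  by move=> j; exact: represents_star.
Qed.

End Ultrapower.

(** * Existence of an enlargement *)

(** Concurrency speaks of tuples in the domain, so entries outside it are dropped when the list is
    turned into a tuple. *)
Lemma concurrent_seq (r : superstr nat) (s : seq (superstr nat)) :
  concurrent r -> exists b, forall a, List.In a s -> sdomain r a -> holds r a b.
Proof.
move=> [_ conc].
have [n [f [fd fs]]] : exists n (f : 'I_n -> superstr nat),
    (forall i, sdomain r (f i)) /\
    forall a, List.In a s -> sdomain r a -> exists i, a = f i.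
  elim: s => [|a s [n [f [fd fs]]]].
    by exists 0, (fun=> atom 0); split=> [[]|].
  have [da|nda] := pselect (sdomain r a); last first.
    by exists n, f; split=> // b [<-//|]; exact: fs.
  exists n.+1, (fun i => oapp f a (unlift ord0 i)).
  split=> [i|b [<- _|bs db]]; first by case: unliftP => [k _|_] /=.
    by exists ord0; rewrite unlift_none.
  by have [i ->] := fs b bs db; exists (lift ord0 i); rewrite liftK.
have [b fb] := conc n f fd; exists b => a /fs h /h[i ->]; exact: fb.
Qed.

(** The index set consists of the finite lists of objects, and the ultrafilter
    contains the lists through any given object: [g s] then only has to dominate
    the finitely many elements of [s], for every concurrent relation at once. *)
Lemma enlargement_ex : exists (Y : Type) (incl : nat -> Y)
  (star : superstr nat -> superstr Y), enlargement incl star.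
Proof.
pose I := seq (superstr nat).
pose cone (s : I) : set I := [set t | forall a, List.In a s -> List.In a t].
have [U [ultraU coneU]] : exists U, UltraFilter U /\ filter_from setT cone `<=` U.
  apply: ultraFilterLemma; apply: filter_from_proper; last by move=> s _; exists s.
  apply: filter_from_filter; first by exists [::].
  move=> s t _ _; exists (s ++ t) => // u stu.
  by split=> a ua; apply: stu; apply/List.in_or_app; [left|right].
exists (upower U), (fun n => class U (fun=> n)), (star ultraU).
split=> [|r conc]; first exact: star_extension.
pose good (s : I) (c : stage nat (rank r)) :=
  forall a, List.In a s -> sdomain r a -> holds r a (denote c).
(* Bounds are sought in the single stage [rank r], to give a family that can be collapsed; where
   none is good the value is a default. *)
have /choice[g gP] : forall s : I, exists c, (exists c', good s c') -> good s c.
  move=> s; have [[c sc]|nc] := pselect (exists c, good s c); first by exists c.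
  by exists (stage0 _).
exists (denote (col U g)) => a ra.
have grep : represents (fun s => denote (g s)) (denote (col U g)).
  exact: represents_col.
(* Variables 0, 1 and 2 stand for the relation, the point and its bound; later indices merely repeat
   the bound. *)
pose e j : superstr (upower U) :=
  if j is j'.+1 then if j' is 0 then star ultraU a else denote (col U g)
  else star ultraU r.
pose ef j : I -> superstr nat :=
  if j is j'.+1 then if j' is 0 then fun=> a else fun s => denote (g s)
  else fun=> r.
have efe j : represents (ef j) (e j).
  by case: j => [|[|j]] //=; exact: represents_star.
suff /(los ultraU _ efe)[p pr /sat_fopair pE] : U [set s |
    sat (fun j => ef j s) (BEx 0 (fopair 0 2 3))].
  by rewrite /holds -[X in smem X _]pE.
have : U (cone [:: a]) by apply: coneU; exists [:: a].
apply: filterS => s /(_ a (or_introl erefl)) sa.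
have rab : holds r a (denote (g s)).
  apply: gP => //; have [b sb] := concurrent_seq s conc.
  (* Since [a] occurs in [s], [b] is related to it and lies three memberships below [r], hence
     occurs in the stage [rank r]. *)
  have rb : rank b <= rank r.
    have mb : smem b (upair a b) by apply/mem_upair; right.
    apply: ltnW; apply: ltn_trans (smem_rank mb) _.
    exact: ltn_trans (smem_rank (mem_opair a b)) (smem_rank (sb a sa ra)).
  have [c bc] := raises_to_ex (rep b) rb; exists c => a' a's ra'.
  by rewrite -(raises_to_uniq bc (denoteP c)); exact: sb.
by exists (opair a (denote (g s))) => //; apply/sat_fopair.
Qed.

Theorem theorem3p1 (F G : set_system nat) (hF : UltraFilter F)
    (hG : UltraFilter G) :
  [<-> tilde_divides F G;
       forall (Y : Type) (incl : nat -> Y) (star : superstr nat -> superstr Y),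
         enlargement incl star ->
         exists x y : Y, ultra star x = F /\ ultra star y = G /\ star_divides star x y;
       exists (Y : Type) (incl : nat -> Y) (star : superstr nat -> superstr Y),
         enlargement incl star /\
         exists x y : Y, ultra star x = F /\ ultra star y = G /\ star_divides star x y].
Proof.
tfae.
- by move=> FG Y incl star; exact: tilde_divides_star.
- move=> FG; have [Y [incl [star enl]]] := enlargement_ex.
  by exists Y, incl, star; split=> //; exact: FG enl.
- move=> [Y [incl [star [[ext _] [x [y [xF [yG xy]]]]]]]] A [FA uA].
  by rewrite -yG; apply: (star_divides_upward ext uA xy); rewrite xF.
Qed.
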